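(* Let $n\ge 1$ be an integer, let $\mathbb{H}^n$ be real hyperbolic space with its canonical metric and let $U\mathbb{H}^n$ be its unit tangent bundle. There exists a Riemannian metric $g_{\mathrm{Hopf}}$ on $U\mathbb{H}^n$ such that, for every $s\in\mathbb{R}$, the time-$s$ geodesic flow map $\phi_s:U\mathbb{H}^n\to U\mathbb{H}^n$ is an isometry of $(U\mathbb{H}^n,g_{\mathrm{Hopf}})$, i.e. $\phi_s^*g_{\mathrm{Hopf}}=g_{\mathrm{Hopf}}$.
   Context: Let $q(x,y)=-x_0y_0+\sum_{i=1}^n x_iy_i$ on $\mathbb{R}^{n+1}$. Real hyperbolic space is $\mathbb{H}^n=\{x\in\mathbb{R}^{n+1}\mid q(x,x)=-1,\ x_0>0\}$. For $a\in\mathbb{H}^n$ the tangent space $T_a\mathbb{H}^n$ is identified with the $q$-orthogonal complement of $a$, on which $q$ restricts to a positive definite form; this defines the canonical Riemannian metric $g$ of $\mathbb{H}^n$. The unit tangent bundle is $U\mathbb{H}^n=\{(x,v)\in\mathbb{R}^{n+1}\times\mathbb{R}^{n+1}\mid q(x,x)=-1,\ x_0>0,\ q(x,v)=0,\ q(v,v)=1\}$, a smooth submanifold of $\mathbb{R}^{n+1}\times\mathbb{R}^{n+1}$. The geodesic flow is $\phi_s(x,v)=(\gamma(s),\gamma'(s))$, where $\gamma$ is the geodesic of $(\mathbb{H}^n,g)$ with $\gamma(0)=x$, $\gamma'(0)=v$; explicitly $\phi_s(x,v)=(\cosh(s)\,x+\sinh(s)\,v,\ \sinh(s)\,x+\cosh(s)\,v)$.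 Riemannian metrics are smooth. *)

(* Defs.v *)
From HB Require Import structures.
From mathcomp Require Import all_boot all_order all_algebra.
From mathcomp Require Import all_classical all_reals all_analysis ring lra.
Set Implicit Arguments.
Unset Strict Implicit.
Unset Printing Implicit Defensive.
Import Order.TTheory GRing.Theory Num.Theory.
Import numFieldNormedType.Exports.
Local Open Scope classical_set_scope.
Local Open Scope ring_scope.

Section Smooth.
Context {R : realType}.
Implicit Types V W : normedModType R.

(* Intended for finite-dimensional V, where being C^{k+1} on an open U means    *)
(* being differentiable on U with all directional derivatives C^k on U.        *)
Fixpoint Ck_on V W (k : nat) (U : set V) (f : V -> W) : Prop :=
  if k is k'.+1 then
    (forall x, U x -> differentiable f x) /\
    (forall v : V, Ck_on k' U ('D_v f))
  else forall x, U x -> {for x, continuous f}.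

Definition smooth_on V W (U : set V) (f : V -> W) : Prop :=
  forall k, Ck_on k U f.

(* Smoothness of a map whose relevant domain is an arbitrary subset M of V      *)
(* (e.g. an embedded submanifold): local existence of smooth extensions to     *)
(* open sets of V. The values of f outside M are irrelevant.                   *)
Definition smooth_within V W (M : set V) (f : V -> W) : Prop :=
  forall p, M p -> exists (U : set V) (F : V -> W),
    [/\ open_nbhs p U, smooth_on U F & forall x, M x -> U x -> F x = f x].

End Smooth.

(* Submanifolds are represented by their underlying sets M in the ambient      *)
(* space V. Maps of M and tensor fields on M are total functions; only their   *)
(* values on M (resp. on vectors tangent to M) are ever constrained.           *)
Section Submanifold.
Context {R : realType} {V : normedModType R}.
Implicit Types (M : set V) (p u v w : V) (g : V -> V -> V -> R).

(* Smooth curves in M, defined near time 0, at p with velocity u. *)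
Definition curve_through M p u : set (R -> V) :=
  [set c : R -> V | [/\ c 0 = p, derive1 c 0 = u &
    exists I : set R, [/\ open_nbhs 0 I, smooth_on I c &
                         forall t, I t -> M (c t)]]].

Definition tangent_space M p : set V := [set u | curve_through M p u !=set0].

Definition vector_field M (X : V -> V) : Prop :=
  smooth_within M X /\ forall p, M p -> tangent_space M p (X p).

(* d f_p (u) is the velocity at 0 of f \o c, where c is any curve in M at p     *)
(* with velocity u: for u tangent to M and f smooth on M it does not depend    *)
(* on the choice of c (chain rule).                                            *)
Definition differential M (f : V -> V) p u : V :=
  derive1 (f \o xget (cst p) (curve_through M p u)) 0.

(* Smoothness of the tensor g is smoothness of g(X, Y) for all smooth vector    *)
(* fields X, Y on M.                                                           *)
Definition riemannian_metric M g : Prop :=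
  [/\ forall p, M p -> forall u v w (a : R),
        tangent_space M p u -> tangent_space M p v -> tangent_space M p w ->
        g p (a *: u + v) w = a * g p u w + g p v w,
      forall p, M p -> forall u v,
        tangent_space M p u -> tangent_space M p v -> g p u v = g p v u,
      forall p, M p -> forall u, tangent_space M p u -> u != 0 -> 0 < g p u u &
      forall X Y, vector_field M X -> vector_field M Y ->
        smooth_within M (fun p => g p (X p) (Y p) : R^o)].

(* f^* g *)
Definition pullback M (f : V -> V) g : V -> V -> V -> R :=
  fun p u v => g (f p) (differential M f p u) (differential M f p v).

Definition diffeomorphism M (f : V -> V) : Prop :=
  [/\ forall p, M p -> M (f p), smooth_within M f &
      exists h : V -> V, [/\ forall p, M p -> M (h p), smooth_within M h,
        forall p, M p -> h (f p) = p & forall p, M p -> f (h p) = p]].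

Definition riemannian_isometry M g (f : V -> V) : Prop :=
  diffeomorphism M f /\
  forall p u v, M p -> tangent_space M p u -> tangent_space M p v ->
    pullback M f g p u v = g p u v.

End Submanifold.

Section Hyperbolic.
Context {R : realType} {n : nat}.
Local Notation E := 'rV[R]_n.+1.
Implicit Types (x v a w : E) (c X : R -> E) (p : E * E).

Definition lorentz x w : R :=
  - (x ord0 ord0 * w ord0 ord0)
  + \sum_(i < n) x ord0 (lift ord0 i) * w ord0 (lift ord0 i).

Definition hyperbolic_space : set E :=
  [set x | lorentz x x = -1 /\ 0 < x ord0 ord0].

Definition unit_tangent_bundle : set (E * E) :=
  [set p | [/\ hyperbolic_space p.1, lorentz p.1 p.2 = 0 & lorentz p.2 p.2 = 1]].

(* T_a H^n is the lorentz-orthogonal complement of a, with the restriction of   *)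
(* lorentz as metric; since lorentz a a = -1, tangent_proj a is the orthogonal *)
(* projection onto T_a H^n. The Levi-Civita connection of H^n is the           *)
(* tangential part of the flat connection of R^(n+1).                          *)
Definition tangent_proj a w : E := w + lorentz w a *: a.

Definition covariant_derivative c X : R -> E :=
  fun s => tangent_proj (c s) (derive1 X s).

Definition geodesic c : Prop :=
  [/\ smooth_on setT c, forall s, hyperbolic_space (c s) &
      forall s, covariant_derivative c (derive1 c) s = 0].

Definition geodesic_from p : set (R -> E) :=
  [set c : R -> E | [/\ geodesic c, c 0 = p.1 & derive1 c 0 = p.2]].

(* The geodesic from a unit tangent vector exists and is unique: geodesic_flowE *)
(* below gives the resulting explicit formula.                                 *)
Definition geodesic_flow (s : R) p : E * E :=
  let c := xget (cst p.1) (geodesic_from p) in (c s, derive1 c s).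

End Hyperbolic.

Arguments hyperbolic_space : clear implicits.
Arguments unit_tangent_bundle : clear implicits.

Section GeodesicFlow.
Context {R : realType} {n : nat}.
Local Notation E := 'rV[R]_n.+1.
Implicit Types (x v a b w : E) (c : R -> E).

Lemma lorentzC x w : lorentz x w = lorentz w x.
Proof.
by rewrite /lorentz mulrC; congr (_ + _); apply: eq_bigr => i _; rewrite mulrC.
Qed.

Lemma lorentzDl x v w : lorentz (x + v) w = lorentz x w + lorentz v w.
Proof.
rewrite /lorentz !mxE mulrDl opprD addrACA -big_split /=.
by congr (_ + _); apply: eq_bigr => i _; rewrite !mxE mulrDl.
Qed.

Lemma lorentzZl (k : R) x w : lorentz (k *: x) w = k * lorentz x w.
Proof.
rewrite /lorentz !mxE -mulrA -mulrN mulrDr; congr (_ + _).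
by rewrite big_distrr; apply: eq_bigr => i _; rewrite /= !mxE mulrA.
Qed.

Lemma lorentzDr x v w : lorentz w (x + v) = lorentz w x + lorentz w v.
Proof. by rewrite !(lorentzC w) lorentzDl. Qed.

Lemma lorentzZr (k : R) x w : lorentz w (k *: x) = k * lorentz w x.
Proof. by rewrite !(lorentzC w) lorentzZl. Qed.

Let lorentzE := (lorentzDl, lorentzDr, lorentzZl, lorentzZr).

Lemma is_derive_coord c (dc : E) (t : R) i j :
  is_derive t 1 c dc -> is_derive t 1 (fun s => c s i j) (dc i j).
Proof.
move=> h; have dct : derivable c t 1 by apply: (@ex_derive _ _ _ _ _ _ _ h).
apply: DeriveDef; first exact: ((derivable_mxP c t 1).1 dct).
by have := derive_mx dct; rewrite (@derive_val _ _ _ _ _ _ _ h) => ->; rewrite mxE.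
Qed.

Lemma is_derive_lorentz (c d : R -> E) (dc dd : E) (t : R) :
  is_derive t 1 c dc -> is_derive t 1 d dd ->
  is_derive t 1 (fun s => lorentz (c s) (d s))
    (lorentz dc (d t) + lorentz (c t) dd).
Proof.
move=> hc hd.
have hij i j : is_derive t 1 (fun s => c s i j * d s i j)
    (dc i j * d t i j + c t i j * dd i j).
  have h1 := is_derive_coord i j hc; have h2 := is_derive_coord i j hd.
  rewrite (_ : (fun s => c s i j * d s i j) =
    (fun s => c s i j) * (fun s => d s i j)) //.
  apply: is_derive_eq; rewrite /GRing.scale /=; ring.
have hs : is_derive t 1 (\sum_(i < n) (fun s => c s ord0 (lift ord0 i) * d s ord0 (lift ord0 i)))
  (\sum_(i < n) (dc ord0 (lift ord0 i) * d t ord0 (lift ord0 i) + c t ord0 (lift ord0 i) * dd ord0 (lift ord0 i))).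
  by apply: is_derive_sum => i.
have h0 := is_deriveN (hij ord0 ord0).
have H := is_deriveD h0 hs.
move: H; set F := (X in is_derive _ _ X _); set D := (X in is_derive _ _ _ X).
move=> H; have -> : (fun s => lorentz (c s) (d s)) = F.
  by apply/funext => s; rewrite /F !fctE fct_sumE.
apply: (is_derive_eq H); rewrite /D.
by rewrite /lorentz opprD big_split /= addrACA.
Qed.

Definition exp_curve a b : R -> E := fun s => expR s *: a + expR (- s) *: b.

Lemma diff_exp_curve a b (t h : R) :
  differentiable (exp_curve a b) t /\
  'D_h (exp_curve a b) t = exp_curve (h *: a) (- h *: b) t.
Proof.
have dE : is_derive t 1 (expR : R -> R) (expR t) by exact: is_derive_expR.
have dN : is_derive t 1 (expR \o -%R : R -> R) (- expR (- t)).
  by apply: trigger_derive; rewrite /GRing.scale /= mulrN1.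
have hE := (derivable1_diffP _ _).1 (@ex_derive _ _ _ _ _ _ _ dE).
have hN := (derivable1_diffP _ _).1 (@ex_derive _ _ _ _ _ _ _ dN).
have hEa := differentiableZl a hE; have hNb := differentiableZl b hN.
split; first exact: differentiableD.
rewrite deriveE; last exact: differentiableD.
have e1 : 'd (fun s : R => expR s *: a) t h = (h * expR t) *: a.
  have -> := congr1 (fun f => f h) (diffZl a hE).
  have -> := congr1 (fun f => f h) (diff1E hE).
  by rewrite derive1E (@derive_val _ _ _ _ _ _ _ dE).
have e2 : 'd (fun s : R => (expR \o -%R) s *: b) t h = (h * - expR (- t)) *: b.
  have -> := congr1 (fun f => f h) (diffZl b hN).
  have -> := congr1 (fun f => f h) (diff1E hN).
  by rewrite derive1E (@derive_val _ _ _ _ _ _ _ dN).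
have -> := congr1 (fun f => f h) (diffD hEa hNb).
transitivity ((h * expR t) *: a + (h * - expR (- t)) *: b).
  by rewrite -e1 -e2.
by rewrite /exp_curve !scalerA /=; congr (_ *: _ + _ *: _); ring.
Qed.

Lemma smooth_exp_curve a b : smooth_on setT (exp_curve a b).
Proof.
move=> k; elim: k a b => [|k IH] a b /=.
  by move=> x _; apply: differentiable_continuous; case: (diff_exp_curve a b x 1).
split=> [x _|v]; first by case: (diff_exp_curve a b x 1).
rewrite (_ : 'D_v _ = exp_curve (v *: a) (- v *: b)); first exact: IH.
by apply/funext => t; case: (diff_exp_curve a b t v).
Qed.

Lemma derive1_exp_curve a b : derive1 (exp_curve a b) = exp_curve a (- b).
Proof.
apply/funext => t; rewrite derive1E; case: (diff_exp_curve a b t 1) => _ ->.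
by rewrite scale1r scaleN1r.
Qed.

Lemma is_derive_smooth c (t : R) : smooth_on setT c -> is_derive t 1 c (derive1 c t).
Proof.
move=> /(_ 1%N) /= [h _]; rewrite derive1E; apply: derivableP.
exact/derivable1_diffP/h.
Qed.

Lemma smooth_derive1 c : smooth_on setT c -> smooth_on setT (derive1 c).
Proof.
move=> hc k; have /= [_ /(_ 1)] := hc k.+1.
by rewrite (_ : derive1 c = 'D_1 c)//; apply/funext => t; rewrite derive1E.
Qed.

Lemma is_derive0_const (f : R -> E) (x y : R) :
  (forall t : R, is_derive t 1 f 0) -> f x = f y.
Proof.
move=> h; apply/matrixP => i j.
apply: (@is_derive_0_is_cst R (fun t => f t i j)) => t.
by have := is_derive_coord i j (h t); rewrite mxE.
Qed.

Lemma unit_tangent_bundle_time p : unit_tangent_bundle R n p ->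
  0 < p.1 ord0 ord0 + p.2 ord0 ord0 /\ 0 < p.1 ord0 ord0 - p.2 ord0 ord0.
Proof.
case: p => x v [/= [qx x0] qxv qv]; move: qx qxv qv.
rewrite /lorentz; set A := \sum_(_ < _) _; set B := \sum_(_ < _) _.
set C := \sum_(_ < _) _; set y := x _ _ in x0 *; set w := v _ _ => hA hB hC.
have sumE (k l : R) : k ^+ 2 * A - 2 * k * l * B + l ^+ 2 * C =
    \sum_(i < n) (k * x ord0 (lift ord0 i) - l * v ord0 (lift ord0 i)) ^+ 2.
  rewrite /A /B /C !big_distrr /= -sumrB -big_split /=.
  by apply: eq_bigr => i _; ring.
have : 0 <= C ^+ 2 * A - 2 * C * B * B + B ^+ 2 * C.
  by rewrite sumE; apply: sumr_ge0 => i _; exact: sqr_ge0.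
have -> : C = 1 + w ^+ 2 by lra.
have -> : B = y * w by lra.
have -> : A = y ^+ 2 - 1 by lra.
rewrite (_ : _ + _ = (1 + w ^+ 2) * (y ^+ 2 - w ^+ 2 - 1)); last by ring.
rewrite pmulr_rge0; last by have := sqr_ge0 w; lra.
move=> h; have hp : 0 < (y + w) * (y - w) by rewrite mulrC -subr_sqr; lra.
have [yw|yw] := ltP 0 (y + w).
  by split=> //; move: hp; rewrite pmulr_rgt0.
have yw' : 0 <= y - w by lra.
by have := mulr_le0_ge0 yw yw'; rewrite leNgt hp.
Qed.

Lemma geodesic_exp_curve p : unit_tangent_bundle R n p ->
  geodesic_from p (exp_curve (2^-1 *: (p.1 + p.2)) (2^-1 *: (p.1 - p.2))).
Proof.
case: p => x v [/= [qx x0] qxv qv]; set a := _ *: _; set b := _ *: _.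
have ee (s : R) : expR s * expR (- s) = 1 by rewrite -expRD subrr expR0.
have qaa : lorentz a a = 0.
  by rewrite /a !lorentzE qx qv qxv (lorentzC v) qxv; field.
have qbb : lorentz b b = 0.
  by rewrite /b -scaleN1r !lorentzE qx qv qxv (lorentzC v) qxv; field.
have qab : lorentz a b = - 2^-1.
  by rewrite /a /b -scaleN1r !lorentzE qx qv qxv (lorentzC v) qxv; field.
have H s : lorentz (exp_curve a b s) (exp_curve a b s) = -1.
  move: (a) (b) qaa qbb qab => {}a {}b qaa qbb qab; rewrite /exp_curve !lorentzE qaa qbb (lorentzC b) qab.
  have := ee s; set e := expR s; set f := expR (- s) => ef.
  rewrite (_ : _ + _ = - (e * f)); last by field.
  by rewrite ef.
split => /=.
- split; first exact: smooth_exp_curve.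
  + move=> s; split; first exact: H.
    have [] := @unit_tangent_bundle_time (x, v); first by [].
    move=> /= h1 h2; rewrite /exp_curve /a /b !mxE.
    by apply: addr_gt0; rewrite !mulr_gt0 ?expR_gt0 ?invr_gt0.
  + move=> s; rewrite /covariant_derivative !derive1_exp_curve opprK.
    by rewrite /tangent_proj H scaleN1r subrr.
- rewrite /exp_curve oppr0 expR0 !scale1r /a /b.
  by apply/matrixP => i j; rewrite !mxE; field.
- rewrite derive1_exp_curve /exp_curve oppr0 expR0 !scale1r /a /b.
  by apply/matrixP => i j; rewrite !mxE; field.
Qed.

Lemma geodesic_fromE p c : unit_tangent_bundle R n p -> geodesic_from p c ->
  c = exp_curve (2^-1 *: (p.1 + p.2)) (2^-1 *: (p.1 - p.2)).
Proof.
case: p => x v [/= [qx x0] qxv qv] [[cS cH cG] /= c0 c'0].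
pose c1 := derive1 c; pose c2 := derive1 c1.
have d1 (t : R) : is_derive t 1 c (c1 t) := is_derive_smooth t cS.
have d2 (t : R) : is_derive t 1 c1 (c2 t) := is_derive_smooth t (smooth_derive1 cS).
have qcc (t : R) : lorentz (c t) (c t) = -1 by case: (cH t).
have qcc1 (t : R) : lorentz (c t) (c1 t) = 0.
  have := is_derive_lorentz (d1 t) (d1 t).
  rewrite (_ : (fun _ => _) = cst (-1)); last by apply/funext.
  move/(@derive_val _ _ _ _ _ _ _); rewrite derive_cst lorentzC => /esym.
  by move/eqP; rewrite -mulr2n mulrn_eq0 /= => /eqP.
have qc1c1 (t : R) : lorentz (c1 t) (c1 t) = - lorentz (c t) (c2 t).
  have := is_derive_lorentz (d1 t) (d2 t).
  rewrite (_ : (fun _ => _) = cst 0); last by apply/funext.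
  move/(@derive_val _ _ _ _ _ _ _); rewrite derive_cst => /esym/eqP.
  by rewrite addr_eq0 => /eqP.
have c2E (t : R) : c2 t = - (lorentz (c2 t) (c t) *: c t).
  by apply/eqP; rewrite -addr_eq0; apply/eqP; exact: cG t.
have q1 (t : R) : lorentz (c1 t) (c1 t) = 1.
  rewrite -qv -c'0; apply: (@is_derive_0_is_cst R (fun t => lorentz (c1 t) (c1 t))).
  move=> {}t; apply: (is_derive_eq (is_derive_lorentz (d2 t) (d2 t))).
  rewrite (lorentzC (c1 t)) c2E -scaleN1r !lorentzE qcc1 !mulr0; ring.
have {}c2E (t : R) : c2 t = c t.
  by rewrite c2E lorentzC -[lorentz _ _]opprK -qc1c1 q1 scaleN1r opprK.
have dN (t : R) : is_derive t 1 (expR \o -%R : R -> R) (- expR (- t)).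
  by apply: trigger_derive; rewrite /GRing.scale /= mulrN1.
apply/funext => s; apply/matrixP => i j; rewrite /exp_curve !mxE.
have dc (t : R) : is_derive t 1 (fun s => c s i j) (c1 t i j).
  exact: is_derive_coord.
have dc1 (t : R) : is_derive t 1 (fun s => c1 s i j) (c t i j).
  by rewrite -c2E; exact: is_derive_coord.
have P : (c s i j + c1 s i j) * expR (- s) = x i j + v i j.
  transitivity ((c 0 i j + c1 0 i j) * expR (- 0)); last first.
    by rewrite /c1 c0 c'0 oppr0 expR0 mulr1.
  apply: (@is_derive_0_is_cst R (fun s => (c s i j + c1 s i j) * expR (- s))) => t.
  apply: (is_derive_eq (is_deriveM (is_deriveD (dc t) (dc1 t)) (dN t))).
  by rewrite /GRing.scale /= ?fctE; ring.
have M : (c s i j - c1 s i j) * expR s = x i j - v i j.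
  transitivity ((c 0 i j - c1 0 i j) * expR 0); last first.
    by rewrite /c1 c0 c'0 expR0 mulr1.
  apply: (@is_derive_0_is_cst R (fun s => (c s i j - c1 s i j) * expR s)) => t.
  apply: (is_derive_eq (is_deriveM (is_deriveB (dc t) (dc1 t)) (is_derive_expR t))).
  by rewrite /GRing.scale /= ?fctE; ring.
rewrite -P -M; have : expR s * expR (- s) = 1 by rewrite -expRD subrr expR0.
set e := expR s; set f := expR (- s) => ef.
transitivity (c s i j * (e * f)); first by rewrite ef mulr1.
by field.
Qed.

Lemma geodesic_flowE (s : R) p : unit_tangent_bundle R n p ->
  let ch := (expR s + expR (- s)) / 2 in
  let sh := (expR s - expR (- s)) / 2 in
  geodesic_flow s p = (ch *: p.1 + sh *: p.2, sh *: p.1 + ch *: p.2).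
Proof.
move=> hp /=; rewrite /geodesic_flow.
have h := geodesic_exp_curve hp; rewrite (geodesic_fromE hp (xgetPex (cst p.1) (ex_intro _ _ h))).
rewrite derive1_exp_curve /exp_curve.
by congr (_, _); apply/matrixP => i j; rewrite !mxE; field.
Qed.

End GeodesicFlow.

(* Main.v *)
(* For (x, v) in the unit tangent bundle, x + v and x - v are null vectors with
   positive time components, and the geodesic flow multiplies them by e^s and
   e^(-s). Hence it preserves |d(x + v)|^2 / (x_0 + v_0)^2
   + |d(x - v)|^2 / (x_0 - v_0)^2, where |.| is the Euclidean norm; this is positive
   definite on the whole ambient space, and so on the tangent spaces of the bundle. *)
From HB Require Import structures.
Require Import Defs.
From mathcomp Require Import all_boot all_order all_algebra.
From mathcomp Require Import all_classical all_reals all_analysis ring lra.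
Set Implicit Arguments.
Unset Strict Implicit.
Unset Printing Implicit Defensive.
Import Order.TTheory GRing.Theory Num.Theory.
Import numFieldNormedType.Exports.
Local Open Scope classical_set_scope.
Local Open Scope ring_scope.

(** * Calculus of C^k maps on open sets *)

Section SmoothMaps.
Context {R : realType}.
Implicit Types V W : normedModType R.

(** [g - f] vanishes near [x], so it is a little-o remainder with zero differential there, and [g]
    is the sum of [f] and this difference. *)
Lemma near_eq_differentiable V W (f g : V -> W) (x : V) :
  (\near x, f x = g x) -> differentiable f x -> differentiable g x.
Proof.
move=> fg df.
have gx : g x - f x = 0.
  by have /= -> := nbhs_singleton fg; rewrite subrr.
have o0 : (g - f) \o shift x = cst ((g - f) x) + (\0 : {linear V -> W}) +o_ 0 id.
  apply: eqaddoE; rewrite fctE /= fctE gx.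
  rewrite (_ : cst 0 + _ = 0); last by apply/funext => h; rewrite /= !fctE addr0.
  rewrite add0r; apply: eqoE; apply/eqoP => _ /posnumP[eps].
  move: fg; rewrite (near_shift 0) /= => fg.
  near=> h; rewrite /= fctE; have -> : f (h + x) = g (h + x).
    have -> : h + x = (h + (x - 0)) by rewrite subr0.
    by near: h.
  by rewrite subrr normr0 mulr_ge0.
have c0 : continuous (\0 : {linear V -> W}) by move=> ?; exact: cvg_cst.
have dgf : differentiable (g - f) x.
  by apply/diff_locallyP; rewrite (diff_unique c0 o0).
by rewrite -[g](subrK f); exact: differentiableD.
Unshelve. all: by end_near. Qed.

(** The usual formulas for ['D_v] hold only on [U], while [Ck_on] takes total functions; this lemma
    transfers regularity along such formulas. Openness makes the agreement local, so it passes to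
    derivatives. *)
Lemma eq_Ck_on V W k (U : set V) (f g : V -> W) :
  open U -> (forall x, U x -> f x = g x) -> Ck_on k U f -> Ck_on k U g.
Proof.
move=> oU; have nearU x : (forall x, U x -> f x = g x) -> U x -> \near x, f x = g x.
  by move=> fg Ux; apply: filterS (open_nbhs_nbhs (conj oU Ux)).
elim: k f g nearU => [|k IH] f g nearU fg /= Cf.
  move=> x Ux; suff : g @ x --> g x by []; rewrite -(fg x Ux).
  by apply: cvg_trans (Cf x Ux); apply: near_eq_cvg; exact: nearU.
case: Cf => df Df; split=> [x Ux|v].
  by apply: near_eq_differentiable (df x Ux); exact: nearU.
have D x : U x -> 'D_v f x = 'D_v g x by move=> Ux; apply/near_eq_derive/nearU.
apply: IH (D) (Df v) => x h Ux.
by apply: filterS (open_nbhs_nbhs (conj oU Ux)).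
Qed.

Lemma sub_Ck_on V W k (U U' : set V) (f : V -> W) :
  U' `<=` U -> Ck_on k U f -> Ck_on k U' f.
Proof.
move=> UU'; elim: k f => [|k IH] f /=; first by move=> Cf x /UU'; exact: Cf.
by case=> df Df; split=> [x /UU'|v]; [exact: df|exact: IH].
Qed.

(** Product and quotient rules leave factors undifferentiated; these are lowered by one order to
    meet the induction hypothesis. *)
Lemma Ck_onW V W k (U : set V) (f : V -> W) : Ck_on k.+1 U f -> Ck_on k U f.
Proof.
elim: k f => [|k IH] f /=.
  by case=> df _ x Ux; exact/differentiable_continuous/df.
by case=> df Df; split=> // v; exact: IH (Df v).
Qed.

Lemma Ck_onD V W k (U : set V) (f g : V -> W) : open U ->
  Ck_on k U f -> Ck_on k U g -> Ck_on k U (f + g).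
Proof.
move=> oU; elim: k f g => [|k IH] f g /= Cf Cg.
  by move=> x Ux; apply: continuousD; [exact: Cf|exact: Cg].
case: Cf Cg => df Df [dg Dg]; split=> [x Ux|v].
  by apply: differentiableD; [exact: df|exact: dg].
apply: eq_Ck_on (IH _ _ (Df v) (Dg v)) => // x Ux.
by rewrite deriveD//; apply: diff_derivable; [exact: df|exact: dg].
Qed.

Lemma Ck_on_cst V W k (U : set V) (a : W) : Ck_on k U (cst a : V -> W).
Proof.
elim: k a => [|k IH] a /=; first by move=> x _; exact: cvg_cst.
split=> // v; rewrite (_ : 'D_v _ = cst 0) //.
by apply/funext => x; rewrite derive_cst.
Qed.

Lemma derive_linear V W W' (f : V -> W) (L : {linear W -> W'}) (x v : V) :
  continuous L -> differentiable f x -> 'D_v (L \o f) x = L ('D_v f x).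
Proof.
move=> cL df; have dL := linear_differentiable (f x) cL.
rewrite (deriveE v (differentiable_comp df dL)) (deriveE v df) (diff_comp df dL).
by rewrite /= (diff_lin (f x) cL).
Qed.

Lemma Ck_on_linear V W W' k (U : set V) (f : V -> W) (L : {linear W -> W'}) :
  continuous L -> open U -> Ck_on k U f -> Ck_on k U (L \o f).
Proof.
move=> cL oU; elim: k f => [|k IH] f /= Cf.
  by move=> x Ux; apply: continuous_comp; [exact: Cf|exact: cL].
case: Cf => df Df; split=> [x Ux|v].
  by apply: differentiable_comp; [exact: df|exact: linear_differentiable].
apply: eq_Ck_on (IH _ (Df v)) => // x Ux /=.
by rewrite derive_linear//; exact: df.
Qed.

Lemma Ck_on_id V k (U : set V) : Ck_on k U (id : V -> V).
Proof.
case: k => [|k] /=; first by move=> x _; exact: cvg_id.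
split=> [x _|v]; first by [].
rewrite (_ : 'D_v _ = cst v); first exact: Ck_on_cst.
by apply/funext => x; rewrite derive_id.
Qed.

Lemma Ck_onM V k (U : set V) (f g : V -> R^o) : open U ->
  Ck_on k U f -> Ck_on k U g -> Ck_on k U (f * g : V -> R^o).
Proof.
move=> oU; elim: k f g => [|k IH] f g Cf Cg.
  by move=> x Ux; apply: continuousM; [exact: Cf|exact: Cg].
case: (Cf) (Cg) => df Df [dg Dg]; split=> [x Ux|v].
  by apply: differentiableM; [exact: df|exact: dg].
have H := Ck_onD oU (IH _ _ (Ck_onW Cf) (Dg v)) (IH _ _ (Ck_onW Cg) (Df v)).
apply: eq_Ck_on H => // x Ux.
by rewrite deriveM//; apply: diff_derivable; [exact: df|exact: dg].
Qed.

Lemma Ck_onV V k (U : set V) (f : V -> R^o) : open U ->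
  (forall x, U x -> f x != 0) -> Ck_on k U f ->
  Ck_on k U ((fun x => (f x)^-1) : V -> R^o).
Proof.
move=> oU f0; elim: k => [|k IH] Cf.
  by move=> x Ux; apply: cvgV; [exact: f0|exact: Cf].
case: (Cf) => df Df; split=> [x Ux|v].
  by apply: differentiableV; [exact: df|exact: f0].
have CV := IH (Ck_onW Cf).
(* The derivative of [f^-1] is [- f^-2 * 'D_v f]; the induction hypothesis already covers the
   factors [f^-1]. *)
have H := Ck_onM oU (Ck_on_cst _ U (-1 : R^o)) (Ck_onM oU (Ck_onM oU CV CV) (Df v)).
apply: eq_Ck_on H => // x Ux.
rewrite deriveV ?f0//; last by apply: diff_derivable; exact: df.
by rewrite !fctE /GRing.scale /=; field; exact: f0.
Qed.

Lemma Ck_on_sum V W k (U : set V) n (F : 'I_n -> V -> W) : open U ->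
  (forall i, Ck_on k U (F i)) -> Ck_on k U (\sum_i F i).
Proof.
move=> oU CF; apply: (big_ind (Ck_on k U)) => [|f g|i _].
- exact: Ck_on_cst.
- exact: Ck_onD.
- exact: CF.
Qed.

(** * Restrictions of ambient linear maps to [M] *)

Lemma smooth_on_linear V W (U : set V) (L : {linear V -> W}) :
  continuous L -> open U -> smooth_on U L.
Proof.
by move=> cL oU k; have := Ck_on_linear cL oU (Ck_on_id k U).
Qed.

Lemma smooth_within_linear V W (M : set V) (L : {linear V -> W}) (f : V -> W) :
  continuous L -> (forall p, M p -> f p = L p) -> smooth_within M f.
Proof.
move=> cL fL p _; exists setT, L; split.
- by split=> //; exact: openT.
- exact: smooth_on_linear cL openT.
- by move=> x /fL.
Qed.

(** Near time 0 the chosen curve stays in [M], where [f] is [L], so the chain rule for [L] along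
    this curve gives the velocity. *)
Lemma differential_linear V (M : set V) (f : V -> V) (L : {linear V -> V}) p u :
  continuous L -> (forall p, M p -> f p = L p) -> tangent_space M p u ->
  differential M f p u = L u.
Proof.
move=> cL fL Tu; rewrite /differential.
(* Tangency of [u] guarantees a curve, so [xget] does not fall back on [cst p]. *)
have [_ cu [I [I0 Ic cM]]] := xgetPex (cst p) Tu.
set c := xget _ _ in cu Ic cM *.
have dc : differentiable c 0 by have [+ _] := Ic 1%N; apply; case: I0.
rewrite -cu !derive1E -(derive_linear _ cL dc); apply: near_eq_derive.
by apply: filterS (open_nbhs_nbhs I0) => t It /=; apply/fL/cM.
Qed.

End SmoothMaps.

(** * Null coordinates on the unit tangent bundle *)

Section HopfMetric.
Context {R : realType} {n : nat}.
Local Notation E := 'rV[R]_n.+1.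
Local Notation M := (unit_tangent_bundle R n).
Implicit Types (p u v w : E * E) (e s : R) (i : 'I_n.+1).

(* The i-th coordinate of the null vector x + e v; only e = 1 and e = -1 are used. *)
Definition null_coord e i p : R^o := p.1 ord0 i + e * p.2 ord0 i.

Lemma null_coord_is_linear e i : linear (null_coord e i).
Proof.
by move=> a u v; rewrite /null_coord /= !mxE /GRing.scale /=; ring.
Qed.

HB.instance Definition _ e i := GRing.isLinear.Build R (E * E)%type R^o _
  (null_coord e i) (null_coord_is_linear e i).

Lemma continuous_null_coord e i : continuous (null_coord e i).
Proof.
move=> p; apply: cvgD; last apply: cvgMl_tmp.
- by apply: (@continuous_comp _ _ _ fst (fun x : E => x ord0 i));
    [exact: cvg_fst|exact: coord_continuous].
- by apply: (@continuous_comp _ _ _ snd (fun x : E => x ord0 i));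
    [exact: cvg_snd|exact: coord_continuous].
Qed.

Lemma null_coord_gt0 e p : e = 1 \/ e = -1 -> M p -> 0 < null_coord e ord0 p.
Proof.
move=> e1 /unit_tangent_bundle_time[]; rewrite /null_coord.
by case: e1 => ->; rewrite ?mul1r ?mulN1r.
Qed.

(** [x] and [v] are half the sum and half the difference of [x + v] and [x - v]. *)
Lemma null_coord_inj p u : (forall i, null_coord 1 i p = null_coord 1 i u) ->
  (forall i, null_coord (-1) i p = null_coord (-1) i u) -> p = u.
Proof.
case: p u => x v [y w] h1 hN1; have h i := (h1 i, hN1 i); rewrite /null_coord /= in h.
by congr (_, _); apply/matrixP => i j; rewrite ord1; case: (h j); lra.
Qed.

(** * Hyperbolic rotations of the ambient space *)

(** For [a = cosh s] and [b = sinh s] this is the explicit geodesic flow, extended linearly off the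
    bundle. *)
Definition hyperbolic_rotation (a b : R) p : E * E :=
  (a *: p.1 + b *: p.2, b *: p.1 + a *: p.2).

Lemma hyperbolic_rotation_is_linear a b : linear (hyperbolic_rotation a b).
Proof.
by move=> k u v; congr (_, _); apply/matrixP => i j; rewrite /= !mxE; ring.
Qed.

HB.instance Definition _ a b := GRing.isLinear.Build R (E * E)%type (E * E)%type _
  (hyperbolic_rotation a b) (hyperbolic_rotation_is_linear a b).

Lemma continuous_hyperbolic_rotation a b : continuous (hyperbolic_rotation a b).
Proof.
move=> p; have C c d : c *: x.1 + d *: x.2 @[x --> p] --> c *: p.1 + d *: p.2.
  by apply: cvgD; apply: cvgZl_tmp; [exact: cvg_fst|exact: cvg_snd].
exact: cvg_pair (C a b) (C b a).
Qed.

(** As [e * e = 1], the coefficients of [x] and [v] after rotation are [a + e * b] and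
    [e * (a + e * b)]. *)
Lemma null_coord_hyperbolic_rotation e i a b p : e = 1 \/ e = -1 ->
  null_coord e i (hyperbolic_rotation a b p) = (a + e * b) * null_coord e i p.
Proof. by move=> [] ->; rewrite /null_coord /= !mxE; ring. Qed.

Lemma unit_tangent_bundle_hyperbolic_rotation a b p :
  0 < a + b -> 0 < a - b -> (a + b) * (a - b) = 1 -> M p ->
  M (hyperbolic_rotation a b p).
Proof.
move=> ab_gt0 aNb_gt0 ab1 Mp; case: (Mp) => -[qxx _] qxv qvv.
have qvx : lorentz p.2 p.1 = 0 by rewrite lorentzC.
have [x0v0 x0Nv0] := unit_tangent_bundle_time Mp.
(* Half the sum of these two products is the time coordinate [a x_0 + b v_0] of the new base
   point. *)
have q1 := mulr_gt0 ab_gt0 x0v0; have q2 := mulr_gt0 aNb_gt0 x0Nv0.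
split; [split|..]; rewrite /= ?(lorentzDl, lorentzDr, lorentzZl, lorentzZr) ?qxx ?qxv ?qvv ?qvx.
- by move: ab1; lra.
- by rewrite !mxE; lra.
- by ring.
- by move: ab1; lra.
Qed.

(** * The invariant bilinear forms *)

(** The polarisation of [|d(x + e v)|^2 / (x_0 + e v_0)^2]; the base point [p] enters only through
    the denominator. *)
Definition null_form e p u w : R :=
  (\sum_i null_coord e i u * null_coord e i w) * (null_coord e ord0 p ^+ 2)^-1.

Lemma null_formC e p u w : null_form e p u w = null_form e p w u.
Proof. by congr (_ * _); apply: eq_bigr => i _; rewrite mulrC. Qed.

Lemma null_formPl e p u v w (a : R) :
  null_form e p (a *: u + v) w = a * null_form e p u w + null_form e p v w.
Proof.
rewrite /null_form mulrA -mulrDl mulr_sumr -big_split /=; congr (_ * _).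
by apply: eq_bigr => i _; rewrite linearP /GRing.scale /= mulrDl mulrA.
Qed.

Lemma null_form_ge0 e p u : 0 <= null_form e p u u.
Proof.
rewrite mulr_ge0 ?invr_ge0 ?sqr_ge0//.
by apply: sumr_ge0 => i _; rewrite -expr2 sqr_ge0.
Qed.

(** Where the time coordinate is 0, the convention [0^-1 = 0] kills the whole form, hence the
    hypothesis on [p]; elsewhere a zero sum of squares has zero terms. *)
Lemma null_form_eq0 e p u i : null_coord e ord0 p != 0 ->
  null_form e p u u = 0 -> null_coord e i u = 0.
Proof.
move=> p0 /eqP; rewrite mulf_eq0 invr_eq0 sqrf_eq0 (negPf p0) orbF.
rewrite psumr_eq0; last by move=> j _; rewrite -expr2 sqr_ge0.
by move=> /allP /(_ i (mem_index_enum i)) /=; rewrite -expr2 sqrf_eq0 => /eqP.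
Qed.

(** Numerator and denominator are both multiplied by [(a + e * b) ^+ 2]. *)
Lemma null_form_hyperbolic_rotation e a b p u w :
  e = 1 \/ e = -1 -> a + e * b != 0 ->
  null_form e (hyperbolic_rotation a b p)
    (hyperbolic_rotation a b u) (hyperbolic_rotation a b w) = null_form e p u w.
Proof.
move=> e1 k0; rewrite /null_form null_coord_hyperbolic_rotation//.
under eq_bigr => i _ do rewrite !null_coord_hyperbolic_rotation// mulrACA.
rewrite -mulr_sumr -expr2 exprMn invfM mulrACA divff ?mul1r//.
by rewrite sqrf_eq0.
Qed.

Lemma Ck_on_null_form e k (U : set (E * E)) (X Y : E * E -> E * E) :
  open U -> (forall p, U p -> null_coord e ord0 p != 0) ->
  Ck_on k U X -> Ck_on k U Y ->
  Ck_on k U ((fun p => null_form e p (X p) (Y p)) : E * E -> R^o).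
Proof.
move=> oU U0 CX CY.
have CL Z i : Ck_on k U Z -> Ck_on k U (null_coord e i \o Z).
  by apply: Ck_on_linear => //; exact: continuous_null_coord.
(* The identity takes the place of the field here, because the denominator is evaluated at the base
   point itself. *)
have Cid := CL id ord0 (Ck_on_id k U).
have CV : Ck_on k U ((fun p => (null_coord e ord0 p ^+ 2)^-1) : E * E -> R^o).
  have := Ck_onM oU Cid Cid; rewrite /comp => C2.
  apply: (Ck_onV oU _ C2) => p Up.
  by rewrite !fctE mulf_neq0 ?U0.
have Cs := Ck_on_sum oU (fun i => Ck_onM oU (CL X i CX) (CL Y i CY)).
apply: eq_Ck_on (Ck_onM oU Cs CV) => // p _.
by rewrite fctE fct_sumE.
Qed.

(** * The Hopf metric *)

Definition hopf_metric p u w : R := null_form 1 p u w + null_form (-1) p u w.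

Lemma riemannian_metric_hopf : riemannian_metric M hopf_metric.
Proof.
have e1 : (1 = 1 :> R) \/ (1 = -1 :> R) by left.
have eN1 : (-1 = 1 :> R) \/ (-1 = -1 :> R) by right.
split.
- by move=> p _ u v w a _ _ _; rewrite /hopf_metric !null_formPl; ring.
- by move=> p _ u v _ _; rewrite /hopf_metric !(null_formC _ _ u).
(* By contraposition: if the sum of the two nonnegative forms is at most 0, both vanish, hence so do
   all null coordinates of [u]. *)
- move=> p Mp u _; apply: contraNT; rewrite -leNgt => g0.
  have g1 := null_form_ge0 1 p u; have gN1 := null_form_ge0 (-1) p u.
  have p1 := lt0r_neq0 (null_coord_gt0 e1 Mp).
  have pN1 := lt0r_neq0 (null_coord_gt0 eN1 Mp).
  rewrite /hopf_metric in g0.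
  apply/eqP/null_coord_inj => i; rewrite linear0;
    [apply: null_form_eq0 p1 _|apply: null_form_eq0 pN1 _]; lra.
- move=> X Y [sX _] [sY _] p Mp.
  have [U1 [F1 [[oU1 U1p] sF1 FX]]] := sX p Mp.
  have [U2 [F2 [[oU2 U2p] sF2 FY]]] := sY p Mp.
  (* The metric is given by a formula on the ambient space that is smooth where neither denominator
     vanishes. This open set contains the bundle, so evaluating the formula on local extensions of
     [X] and [Y] yields the required extension. *)
  pose N e := null_coord e ord0 @^-1` [set x : R^o | x != 0].
  have oN e : open (N e).
    apply: open_comp; last exact: open_neq.
    by move=> x _; exact: continuous_null_coord.
  exists (U1 `&` U2 `&` (N 1 `&` N (-1))), (fun x => hopf_metric x (F1 x) (F2 x)).
  have oU : open (U1 `&` U2 `&` (N 1 `&` N (-1))) by do !apply: openI.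
  split.
  + split=> //; split; split => //; apply: lt0r_neq0; exact: null_coord_gt0.
  + move=> k; set U := (X in Ck_on k X) in oU *.
    have CF1 : Ck_on k U F1 by apply: sub_Ck_on (sF1 k) => x [[]].
    have CF2 : Ck_on k U F2 by apply: sub_Ck_on (sF2 k) => x [[]].
    have C e (NU : U `<=` N e) := Ck_on_null_form oU NU CF1 CF2.
    have CN1 := C (-1) (fun x Ux => Ux.2.2); have C1 := C 1 (fun x Ux => Ux.2.1).
    exact: Ck_onD oU C1 CN1.
  + by move=> x Mx [[U1x U2x] _]; rewrite FX// FY.
Qed.

(** * The geodesic flow as a linear isometry *)

Definition boost s : E * E -> E * E :=
  hyperbolic_rotation ((expR s + expR (- s)) / 2) ((expR s - expR (- s)) / 2).

Lemma boostE s p : M p -> geodesic_flow s p = boost s p.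
Proof. exact: geodesic_flowE. Qed.

(** This is [cosh s + sinh s], the factor by which the flow scales [x + v]; the difference in
    [boostB] is the factor for [x - v]. *)
Lemma boostD s : (expR s + expR (- s)) / 2 + (expR s - expR (- s)) / 2 = expR s.
Proof. by field. Qed.

Lemma boostB s : (expR s + expR (- s)) / 2 - (expR s - expR (- s)) / 2 = expR (- s).
Proof. by field. Qed.

Lemma unit_tangent_bundle_flow s p : M p -> M (geodesic_flow s p).
Proof.
move=> Mp; rewrite boostE//; apply: unit_tangent_bundle_hyperbolic_rotation => //.
- by rewrite boostD expR_gt0.
- by rewrite boostB expR_gt0.
- by rewrite boostD boostB -expRD subrr expR0.
Qed.

(** In null coordinates both maps are scalings, by reciprocal exponentials. *)
Lemma boostK s p : boost (- s) (boost s p) = p.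
Proof.
have e1 : (1 = 1 :> R) \/ (1 = -1 :> R) by left.
have eN1 : (-1 = 1 :> R) \/ (-1 = -1 :> R) by right.
apply: null_coord_inj => i; rewrite !null_coord_hyperbolic_rotation// mulrA.
  by rewrite !mul1r !boostD -expRD addNr expR0 mul1r.
by rewrite !mulN1r !boostB -expRD addNr expR0 mul1r.
Qed.

Lemma smooth_within_geodesic_flow s : smooth_within M (geodesic_flow s).
Proof.
apply: smooth_within_linear (@boostE s).
exact: continuous_hyperbolic_rotation.
Qed.

Lemma geodesic_flowK s p : M p -> geodesic_flow (- s) (geodesic_flow s p) = p.
Proof.
move=> Mp; rewrite (boostE (- s)); last exact: unit_tangent_bundle_flow.
by rewrite boostE// boostK.
Qed.

Lemma diffeomorphism_geodesic_flow s : diffeomorphism M (geodesic_flow s).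
Proof.
split; [exact: unit_tangent_bundle_flow|exact: smooth_within_geodesic_flow|].
exists (geodesic_flow (- s)); split.
- exact: unit_tangent_bundle_flow.
- exact: smooth_within_geodesic_flow.
- exact: geodesic_flowK.
- by move=> p Mp; have := geodesic_flowK (- s) Mp; rewrite opprK.
Qed.

Lemma riemannian_isometry_geodesic_flow s :
  riemannian_isometry M hopf_metric (geodesic_flow s).
Proof.
split=> [|p u w Mp Tu Tw]; first exact: diffeomorphism_geodesic_flow.
have cL : continuous (boost s) by exact: continuous_hyperbolic_rotation.
(* The flow agrees on the bundle with the linear map [boost s], which is therefore its own
   differential on tangent vectors; only the invariance of each null form remains. *)
rewrite /pullback !(differential_linear cL (@boostE s))// boostE//.
have e1 : (1 = 1 :> R) \/ (1 = -1 :> R) by left.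
have eN1 : (-1 = 1 :> R) \/ (-1 = -1 :> R) by right.
rewrite /hopf_metric /boost !null_form_hyperbolic_rotation//.
  by rewrite mulN1r boostB lt0r_neq0 ?expR_gt0.
by rewrite mul1r boostD lt0r_neq0 ?expR_gt0.
Qed.

End HopfMetric.

Theorem theorem4p6 (R : realType) (n : nat) (hn : (1 <= n)%N) :
  exists gHopf : ('rV[R]_n.+1 * 'rV[R]_n.+1) -> ('rV[R]_n.+1 * 'rV[R]_n.+1) ->
                 ('rV[R]_n.+1 * 'rV[R]_n.+1) -> R,
    riemannian_metric (unit_tangent_bundle R n) gHopf /\
    forall s : R, riemannian_isometry (unit_tangent_bundle R n) gHopf (geodesic_flow s).
Proof.
exists hopf_metric; split; first exact: riemannian_metric_hopf.
exact: riemannian_isometry_geodesic_flow.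
Qed.
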